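(* Let $\mathcal{H}$ be a complex infinite-dimensional Hilbert space, let $n>1$ be an integer, and let $A\in B(\mathcal{H})$ be $n$-normal, i.e. $A^*A^n=A^nA^*$ (equivalently, $A^n$ is a normal operator). Then $A$ is polaroid.
   Context: $B(\mathcal{H})$ denotes the algebra of bounded linear operators on $\mathcal{H}$. For $S\in B(\mathcal{H})$ and $\lambda\in\mathbb{C}$, the ascent $\mathrm{asc}(S-\lambda)$ is the least nonnegative integer $p$ with $(S-\lambda)^{-p}(0)=(S-\lambda)^{-(p+1)}(0)$, and the descent $\mathrm{dsc}(S-\lambda)$ is the least nonnegative integer $p$ with $(S-\lambda)^p(\mathcal{H})=(S-\lambda)^{p+1}(\mathcal{H})$. A point $\lambda$ that is isolated in $\sigma(S)$ is a pole (of the resolvent) of $S$ if $0<\mathrm{asc}(S-\lambda)=\mathrm{dsc}(S-\lambda)<\infty$. $S$ is polaroid if every isolated point of $\sigma(S)$ is a pole of $S$. *)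

(* Defs.v *)
(* Complex Hilbert spaces and bounded operators are set up here from scratch:
   the scalar field is the complex numbers C = R[i] for R : realType, and a
   Hilbert space is a complete normed C-vector space whose norm comes from an
   inner product. *)
From HB Require Import structures.
From mathcomp Require Import all_boot all_order all_algebra.
From mathcomp Require Import all_classical all_reals all_analysis.
From mathcomp Require Import complex.
Import Order.TTheory GRing.Theory Num.Theory.

Set Implicit Arguments.
Unset Strict Implicit.
Unset Printing Implicit Defensive.

Local Open Scope ring_scope.
Local Open Scope classical_set_scope.

Section Hilbert.
Variable R : realType.
Variable V : completeNormedModType R[i].

(* ip is an inner product (linear in the first argument, conjugate symmetric,
   positive definite) inducing the norm of V; completeness is part of
   completeNormedModType, so (V, ip) is a complex Hilbert space. *)
Definition hilbert_inner_product (ip : V -> V -> R[i]) : Prop :=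
  [/\ (forall (a : R[i]) (x y z : V), ip (a *: x + y) z = a * ip x z + ip y z),
      (forall x y : V, ip y x = (ip x y)^*),
      (forall x : V, x != 0 -> 0 < ip x x) &
      (forall x : V, `|x| ^+ 2 = ip x x)].

(* V is infinite-dimensional: for every n there are n linearly independent
   vectors. *)
Definition infinite_dimensional : Prop :=
  forall n : nat, exists f : 'I_n -> V,
    forall c : 'I_n -> R[i], \sum_(i < n) c i *: f i = 0 -> forall i, c i = 0.

(* S belongs to B(H): linear and continuous. *)
Definition bounded_op (S : V -> V) : Prop :=
  (forall (a : R[i]) (x y : V), S (a *: x + y) = a *: S x + S y) /\ continuous S.

(* B is the (Hilbert) adjoint of S w.r.t. ip. *)
Definition is_adjoint (ip : V -> V -> R[i]) (S B : V -> V) : Prop :=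
  forall x y : V, ip (S x) y = ip x (B y).

(* S - lambda *)
Definition shift (S : V -> V) (l : R[i]) : V -> V := fun x => S x - l *: x.

(* spectrum: lambda such that S - lambda is not invertible in B(H) *)
Definition spectrum (S : V -> V) : set R[i] :=
  [set l | ~ exists B : V -> V, [/\ bounded_op B,
             (forall x, B (shift S l x) = x) & (forall x, shift S l (B x) = x)]].

Definition isolated_in (E : set R[i]) (l : R[i]) : Prop :=
  E l /\ exists e : R, 0 < e /\ forall m, E m -> `|m - l| < (e%:C)%C -> m = l.

(* kernel and range of T^p *)
Definition kerp (T : V -> V) (p : nat) : set V := [set x | iter p T x = 0].
Definition ranp (T : V -> V) (p : nat) : set V := [set y | exists x, iter p T x = y].

(* asc T = p, i.e. p is the least nonnegative integer with
   T^{-p}(0) = T^{-(p+1)}(0) *)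
Definition ascent_is (T : V -> V) (p : nat) : Prop :=
  kerp T p = kerp T p.+1 /\ forall q, (q < p)%N -> kerp T q <> kerp T q.+1.

(* dsc T = p, i.e. p is the least nonnegative integer with
   T^p(H) = T^{p+1}(H) *)
Definition descent_is (T : V -> V) (p : nat) : Prop :=
  ranp T p = ranp T p.+1 /\ forall q, (q < p)%N -> ranp T q <> ranp T q.+1.

(* lambda (assumed isolated in the spectrum) is a pole:
   0 < asc (S - lambda) = dsc (S - lambda) < oo *)
Definition is_pole (S : V -> V) (l : R[i]) : Prop :=
  exists p : nat, [/\ (0 < p)%N, ascent_is (shift S l) p & descent_is (shift S l) p].

Definition polaroid (S : V -> V) : Prop :=
  forall l, isolated_in (spectrum S) l -> is_pole S l.

End Hilbert.

(* Main.v *)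
(* Idea.  Let l be isolated in the spectrum of A and put N = A^n, M = N - l^n,
   T = A - l.  Then N is normal and commutes with A and A*.  The heart of the
   matter is a gap: |T M x| >= h |M x| for some h > 0.  Otherwise the
   self-adjoint operator M* (T* T - h^2) M, which commutes with N and N*, takes
   a negative value g as an approximate eigenvalue, and localising further with
   respect to N + N* and i (N* - N) gives w and vectors y = M x such that
   N y ~ w y, |T y| <= h |y| and w <> l^n.  Factoring X^n - w, some root z of it
   close to l, and different from l, lies in the spectrum of A, against
   isolation.  By the gap and the invertibility of T - s for small s > 0, T is a
   bijection of the closure of the range of M.  Writing X^n - l^n = q (X - l)^m
   with q(l) <> 0, this stabilises the kernels and the ranges of the powers of T
   at m, and T is not bijective since l is in the spectrum. *)

Require Import Defs.
From HB Require Import structures.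
From mathcomp Require Import all_boot all_order all_algebra.
From mathcomp Require Import all_classical all_reals all_analysis.
From mathcomp Require Import complex.
From mathcomp Require Import ring lra.
Import Order.TTheory GRing.Theory Num.Theory.
Local Open Scope ring_scope.

Set Implicit Arguments.
Unset Strict Implicit.
Unset Printing Implicit Defensive.

(** * Real-valued norms and bounded linear maps *)

Section RealNorm.
Variables (R : realType) (V : completeNormedModType R[i]).
Implicit Types (x y : V) (c : R[i]).

(* Norms in [V] take values in [R[i]]; [nrm] and [cabs] are their real parts. *)
Definition nrm x : R := complex.Re `|x|.
Definition cabs c : R := complex.Re `|c|.

Lemma nrmE x : `|x| = (nrm x)%:C%C.
Proof. by rewrite /nrm RRe_real // normr_real. Qed.

Lemma cabsE c : `|c| = (cabs c)%:C%C.
Proof. by rewrite /cabs RRe_real // normr_real. Qed.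

Lemma nrm_ge0 x : 0 <= nrm x.
Proof. by rewrite -ler0c -nrmE. Qed.

Lemma cabs_ge0 c : 0 <= cabs c.
Proof. by rewrite -ler0c -cabsE. Qed.

Lemma nrm_eq0 x : nrm x = 0 -> x = 0.
Proof. by move=> x0; apply/normr0_eq0; rewrite nrmE x0. Qed.

Lemma cabs_eq0 c : cabs c = 0 -> c = 0.
Proof. by move=> x0; apply/normr0_eq0; rewrite cabsE x0. Qed.

Lemma nrm0 : nrm 0 = 0.
Proof. by rewrite /nrm normr0. Qed.

Lemma nrmD x y : nrm (x + y) <= nrm x + nrm y.
Proof. by rewrite -lecR rmorphD /= -!nrmE ler_normD. Qed.

Lemma nrmN x : nrm (- x) = nrm x.
Proof. by rewrite /nrm normrN. Qed.

Lemma nrmC x y : nrm (x - y) = nrm (y - x).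
Proof. by rewrite -nrmN opprB. Qed.

Lemma nrmB x y : nrm (x - y) <= nrm x + nrm y.
Proof. by rewrite -(nrmN y); exact: nrmD. Qed.

Lemma nrm_tri x y : nrm x <= nrm y + nrm (x - y).
Proof. by have := nrmD y (x - y); rewrite addrC subrK. Qed.

Lemma nrmZ c x : nrm (c *: x) = cabs c * nrm x.
Proof. by apply: (@complexI R); rewrite -nrmE normrZ nrmE cabsE rmorphM. Qed.

Lemma cabs_real (a : R) : cabs a%:C%C = `|a|.
Proof. by rewrite /cabs normc_def /= expr0n /= addr0 sqrtr_sqr. Qed.

Lemma nrmZr (a : R) x : 0 <= a -> nrm (a%:C%C *: x) = a * nrm x.
Proof. by move=> a0; rewrite nrmZ cabs_real ger0_norm. Qed.

Lemma nrm_gt0 x : x != 0 -> 0 < nrm x.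
Proof.
by move=> x0; rewrite lt_def nrm_ge0 andbT; apply: contra_neq x0; exact: nrm_eq0.
Qed.

Lemma cabs_gt0 c : c != 0 -> 0 < cabs c.
Proof.
by move=> x0; rewrite lt_def cabs_ge0 andbT; apply: contra_neq x0; exact: cabs_eq0.
Qed.

Lemma nrm_complete (u : nat -> V) :
  (forall e : R, 0 < e -> exists n, forall i j, (n <= i)%N -> (n <= j)%N ->
     nrm (u i - u j) < e) ->
  exists l, forall e : R, 0 < e -> exists n, forall i, (n <= i)%N ->
     nrm (l - u i) < e.
Proof.
move=> uc.
have : cvg (u @ \oo)%classic.
  apply: cauchy_cvg; apply: cauchy_exP => e.
  (* A positive element of [R[i]] has zero imaginary part, so the tolerance is a real number. *)
  case: e => e e'; rewrite ltcE /= => /andP[/eqP-> e0].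
  have [n un] := uc _ e0.
  exists (u n); exists n => //= k nk.
  by rewrite -ball_normE /= nrmE ltcR un.
move=> /cvgrPdist_lt ul; exists (limn u) => e e0.
have /ul[n _ un] : 0 < e%:C%C :> R[i] by rewrite ltcR.
by exists n => i /un; rewrite nrmE ltcR.
Qed.

Definition islin (f : V -> V) :=
  forall (a : R[i]) x y, f (a *: x + y) = a *: f x + f y.

Definition blin f :=
  islin f /\ exists2 C : R, 0 < C & forall x, nrm (f x) <= C * nrm x.

Section Islin.
Variable f : V -> V.
Hypothesis fl : islin f.
Lemma linD x y : f (x + y) = f x + f y.
Proof. by have := fl 1 x y; rewrite !scale1r. Qed.
Lemma lin0 : f 0 = 0.
Proof. by apply: (addrI (f 0)); rewrite -linD !addr0. Qed.
Lemma linZ c x : f (c *: x) = c *: f x.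
Proof. by have := fl c x 0; rewrite !addr0 lin0 addr0. Qed.
Lemma linN x : f (- x) = - f x.
Proof. by rewrite -[in LHS]scaleN1r linZ scaleN1r. Qed.
Lemma linB x y : f (x - y) = f x - f y.
Proof. by rewrite linD linN. Qed.
End Islin.

Lemma bounded_op_blin f : bounded_op f -> blin f.
Proof.
move=> [fl fc]; split=> //.
have /cvgrPdist_lt/(_ 1 ltr01) := fc 0.
rewrite (lin0 fl) => /nbhs_ballP[e /=].
case: e => e e'; rewrite ltcE /= => /andP[/eqP-> e0] fe.
exists (2 / e) => [|x]; first by rewrite divr_gt0.
have [->|x0] := eqVneq x 0; first by rewrite (lin0 fl) nrm0 mulr0.
have nx := nrm_gt0 x0.
(* Scaling [x] by [c] gives a vector of norm e/2, inside the ball where the values of [f] have norm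
   below 1. *)
pose c := e / (2 * nrm x).
have c0 : 0 < c by rewrite divr_gt0 // mulr_gt0.
have := fe (c%:C%C *: x).
rewrite (linZ fl) -ball_normE /= !sub0r !normrN !nrmE !ltcR !nrmZr ?(ltW c0) // => H.
have {H} : c * nrm (f x) < 1.
  have : (c * nrm x) < e.
    rewrite /c -mulrA invfM -mulrA mulVf ?gt_eqF // mulr1.
    by rewrite ltr_pdivrMr // ltr_pMr // ltr1n.
  by move=> /H.
have -> : 2 / e * nrm x = c^-1 by rewrite /c; field; rewrite !gt_eqF.
by rewrite -ltr_pdivlMl // mulr1 => /ltW.
Qed.

Lemma blin_bounded_op f : blin f -> bounded_op f.
Proof.
move=> [fl [C C0 fC]]; split=> // x.
apply/cvgrPdist_lt; case=> e e'; rewrite ltcE /= => /andP[/eqP-> e0].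
apply/nbhs_ballP; exists (e / C)%:C%C; first by rewrite /= ltcR divr_gt0.
move=> y; rewrite -ball_normE /= !nrmE !ltcR -(linB fl) => xy.
by rewrite (le_lt_trans (fC _)) // -ltr_pdivlMl // mulrC.
Qed.

Lemma blin_comp f g : blin f -> blin g -> blin (fun x => f (g x)).
Proof.
move=> [fl [C C0 fC]] [gl [D D0 gD]]; split=> [a x y|]; first by rewrite gl fl.
exists (C * D) => [|x]; first exact: mulr_gt0.
by rewrite (le_trans (fC _)) // -mulrA ler_pM2l.
Qed.

Lemma blin_add f g : blin f -> blin g -> blin (fun x => f x + g x).
Proof.
move=> [fl [C C0 fC]] [gl [D D0 gD]]; split=> [a x y|].
  by rewrite gl fl scalerDr addrACA.
exists (C + D) => [|x]; first exact: addr_gt0.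
by rewrite (le_trans (nrmD _ _)) // mulrDl lerD.
Qed.

Lemma blin_scale c f : blin f -> blin (fun x => c *: f x).
Proof.
move=> [fl [C C0 fC]]; split=> [a x y|].
  by rewrite fl scalerDr !scalerA mulrC.
exists ((cabs c + 1) * C) => [|x].
  by rewrite mulr_gt0 // ltr_wpDl // cabs_ge0.
rewrite nrmZ -mulrA ler_pM ?cabs_ge0 ?nrm_ge0 //.
by rewrite lerDl.
Qed.

Lemma blin_id : blin id.
Proof. by split=> //; exists 1 => // x; rewrite mul1r. Qed.

Lemma blin_sub f g : blin f -> blin g -> blin (fun x => f x - g x).
Proof.
move=> bf bg; have := blin_add bf (blin_scale (-1) bg).
by congr blin; apply/funext => x; rewrite scaleN1r.
Qed.

Lemma blin_shift f c : blin f -> blin (Defs.shift f c).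
Proof. by move=> bf; exact: (blin_sub bf (blin_scale c blin_id)). Qed.

Lemma blin_iter f n : blin f -> blin (iter n f).
Proof.
by move=> bf; elim: n => [|n IH] /=; [exact: blin_id | exact: blin_comp].
Qed.

End RealNorm.

(** * The real inner product, adjoints, and joint approximate eigenvectors *)

Section RealInnerProduct.
Variables (R : realType) (V : completeNormedModType R[i]) (ip : V -> V -> R[i]).
Hypothesis hip : hilbert_inner_product ip.
Implicit Types (x y z : V) (c : R[i]) (f g S : V -> V).

(* [Re ip] turns [V] into a real Hilbert space with the same norm, and an
   adjoint for [ip] is an adjoint for [Re ip]. *)
Definition rip x y : R := complex.Re (ip x y).

Lemma ripC x y : rip x y = rip y x.
Proof. by case: hip => _ h _ _; rewrite /rip (h y x); case: (ip y x). Qed.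

Lemma ripDl x y z : rip (x + y) z = rip x z + rip y z.
Proof.
case: hip => h _ _ _; rewrite /rip -[x + y]/(x + y) -{1}(scale1r x) h mul1r.
by case: (ip x z) => a b; case: (ip y z).
Qed.

Lemma ip0l z : ip 0 z = 0.
Proof.
case: hip => h _ _ _; have := h 1 0 0 z; rewrite scale1r addr0 mul1r.
by move=> /eqP; rewrite -subr_eq0 opprD addNKr oppr_eq0 => /eqP.
Qed.

Lemma ipZl c x z : ip (c *: x) z = c * ip x z.
Proof. by case: hip => h _ _ _; rewrite -[c *: x]addr0 h ip0l addr0. Qed.

Lemma ripZl (a : R) x z : rip (a%:C%C *: x) z = a * rip x z.
Proof. by rewrite /rip ipZl; case: (ip x z) => b d /=; rewrite mul0r subr0. Qed.

Lemma ripZadj c x y : rip (c *: x) y = rip x (conjc c *: y).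
Proof.
rewrite [RHS]ripC /rip !ipZl; case: hip => _ h _ _; rewrite (h x y).
by case: (ip x y) c => a b [d e] /=; ring.
Qed.

Lemma ripZadjr c x y : rip x (c *: y) = rip (conjc c *: x) y.
Proof. by rewrite ripC ripZadj ripC. Qed.

Lemma ripNl x z : rip (- x) z = - rip x z.
Proof.
have -> : - x = (-1 : R)%:C%C *: x by rewrite rmorphN1 scaleN1r.
by rewrite ripZl mulN1r.
Qed.

Lemma ripBl x y z : rip (x - y) z = rip x z - rip y z.
Proof. by rewrite ripDl ripNl. Qed.

Lemma ripDr x y z : rip z (x + y) = rip z x + rip z y.
Proof. by rewrite ripC ripDl !(ripC z). Qed.

Lemma ripBr x y z : rip z (x - y) = rip z x - rip z y.
Proof. by rewrite ripC ripBl !(ripC z). Qed.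

Lemma ripZr (a : R) x z : rip z (a%:C%C *: x) = a * rip z x.
Proof. by rewrite ripC ripZl ripC. Qed.

Lemma rip_nrm x : rip x x = nrm x ^+ 2.
Proof.
case: hip => _ _ _ h; rewrite /rip -(h x) nrmE -rmorphXn //.
Qed.

Lemma cauchy_schwarz x y : rip x y <= nrm x * nrm y.
Proof.
have [->|x0] := eqVneq x 0; first by rewrite nrm0 mul0r /rip ip0l.
have [->|y0] := eqVneq y 0; first by rewrite nrm0 mulr0 ripC /rip ip0l.
have nx := nrm_gt0 x0; have ny := nrm_gt0 y0.
(* With a, b the norms of [x], [y] and r = [rip x y], this square is 2 a b (a b - r). *)
have : 0 <= nrm ((nrm y)%:C%C *: x - (nrm x)%:C%C *: y) ^+ 2 by exact: sqr_ge0.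
rewrite -rip_nrm ripBl !ripBr !ripZl !ripZr !rip_nrm (ripC y x).
set a := nrm x in nx *; set b := nrm y in ny *; set r := rip x y => H.
have : 0 <= (a * b) * (a * b - r) by nra.
by rewrite pmulr_rge0 ?mulr_gt0 // subr_ge0.
Qed.

Lemma rip_inj x y : (forall z, rip z x = rip z y) -> x = y.
Proof.
move=> h; apply/eqP; rewrite -subr_eq0; apply/eqP/nrm_eq0/eqP.
by rewrite -sqrf_eq0 -rip_nrm ripBr h subrr.
Qed.

Definition radj f g := forall x y, rip (f x) y = rip x (g y).

Lemma radjC f g : radj f g -> radj g f.
Proof. by move=> h x y; rewrite ripC -h ripC. Qed.

Lemma radj_shift c f f' : radj f f' -> radj (Defs.shift f c) (Defs.shift f' (conjc c)).
Proof. by move=> h x y; rewrite ripBl ripBr h ripZadj. Qed.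

Lemma radj_iter n f f' : radj f f' -> radj (iter n f) (iter n f').
Proof.
move=> h; elim: n => [//|n IH] x y; rewrite [in RHS]iterSr -IH.
exact: h.
Qed.

Lemma radj_blin f f' : blin f -> radj f f' -> blin f'.
Proof.
move=> [fl [C C0 fC]] h; split=> [a x y|].
  apply: rip_inj => z.
  by rewrite -h !ripDr !ripZadjr h -(linZ fl) h.
exists C => // x; have [->|x0] := eqVneq (f' x) 0.
  by rewrite nrm0 mulr_ge0 ?nrm_ge0 ?ltW.
have nx := nrm_gt0 x0.
(* By adjunction |f' x|^2 = (f (f' x), x) <= C |f' x| |x|, and one factor |f' x| cancels. *)
rewrite -(ler_pM2l nx) -expr2 -rip_nrm -h (le_trans (cauchy_schwarz _ _)) //.
rewrite mulrA [_ * C]mulrC ler_wpM2r ?nrm_ge0 //.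
Qed.

Definition jnull (Ps : set (V -> V)) (e : R) x :=
  forall P, Ps P -> nrm (P x) <= e * nrm x.

(** This puts 0 in the joint approximate point spectrum of the family. Adjoining [shift S g] to the
    family records [g] as an approximate eigenvalue of [S] along vectors that the other members
    almost kill. *)
Definition jsing Ps := forall e : R, 0 < e -> exists2 x, x != 0 & jnull Ps e x.

(* [g] is the limit, as [e] tends to 0, of the infimum of the quadratic form of
   [S] over unit [e]-null vectors. An almost minimising [x] is almost an
   eigenvector: compare [x] with [x - (S - g) x / (2 c)], which is again almost
   null because [S] commutes with the family. *)
Lemma jsing_localize Ps S :
  (forall P, Ps P -> islin P /\ forall x, P (S x) = S (P x)) ->
  blin S -> radj S S -> jsing Ps ->
  exists g : R, jsing (Ps `|` [set Defs.shift S g%:C%C])%classic /\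
    forall x, (forall P, Ps P -> P x = 0) -> g * nrm x ^+ 2 <= rip (S x) x.
Proof.
move=> PsS bS sS sing; have [Sl [C C0 SC]] := bS.
have ripS x : `|rip (S x) x| <= C * nrm x ^+ 2.
  rewrite ler_norml; apply/andP; split; last first.
    rewrite (le_trans (cauchy_schwarz _ _)) // expr2 mulrA.
    by rewrite ler_wpM2r ?nrm_ge0.
  rewrite lerNl -ripNl (le_trans (cauchy_schwarz _ _)) // expr2 mulrA nrmN.
  by rewrite ler_wpM2r ?nrm_ge0.
(* Infima over [e]-null vectors increase as [e] decreases, so their limit is the supremum of the
   lower bounds valid at some tolerance. *)
pose E : set R := [set t | exists2 e : R, 0 < e &
  forall x, jnull Ps e x -> t * nrm x ^+ 2 <= rip (S x) x]%classic.
have Eub t : E t -> t <= C.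
  move=> [e e0 te]; have [x x0 /te tx] := sing _ e0.
  have := le_trans tx (le_trans (ler_norm _) (ripS x)).
  by rewrite ler_pM2r // exprn_gt0 // nrm_gt0.
have supE : has_sup E.
  split; last by exists C => t /Eub.
  exists (- C); exists 1 => // x _; rewrite mulNr lerNl.
  by rewrite (le_trans _ (ripS x)) // -normrN ler_norm.
pose g := sup E; exists g; split; last first.
  move=> x Px; have [->|x0] := eqVneq x 0.
    by rewrite nrm0 expr0n mulr0 (lin0 Sl) /rip ip0l.
  have n0 : 0 < nrm x ^+ 2 by rewrite exprn_gt0 // nrm_gt0.
  rewrite -ler_pdivlMr //; apply: ge_sup; first by case: supE.
  move=> t [e e0 te]; rewrite ler_pdivlMr //; apply: te => P /Px ->.
  by rewrite nrm0 mulr_ge0 ?nrm_ge0 ?ltW.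
pose G := Defs.shift S g%:C%C; pose c := C + `|g|.
have c0 : 0 < c by rewrite ltr_pwDl.
have [Gl _] : blin G by exact: blin_shift.
have GC x : nrm (G x) <= c * nrm x.
  by rewrite (le_trans (nrmB _ _)) // nrmZ cabs_real mulrDl lerD.
have sG x y : rip (G x) y = rip x (G y) by rewrite ripBl ripBr sS ripZr ripZl.
(* The final estimate is |G x|^2 <= (13/3) c d |x|^2, which this [d] brings below e^2 |x|^2. *)
move=> e e0; pose d := e ^+ 2 / (6 * c).
have d0 : 0 < d by rewrite divr_gt0 ?mulr_gt0 ?exprn_gt0.
have [t [e1 e10 te1] gt] := sup_adherent d0 supE.
(* The third of [e1] leaves room for [y] below: |P y| <= 3/2 |P x| while |y| >= |x| / 2, so [y] is
   [e1]-null. *)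
pose e' := Num.min e (e1 / 3).
have e'0 : 0 < e' by rewrite lt_min e0 divr_gt0.
have [x [x0 xe' xg]] : exists x, [/\ x != 0, jnull Ps e' x &
    rip (S x) x < (g + d) * nrm x ^+ 2].
  apply: contrapT => /forallNP nx.
  have /(ub_le_sup supE.2) : E (g + d).
    exists e' => // x xe; have [->|x0] := eqVneq x 0.
      by rewrite nrm0 expr0n mulr0 (lin0 Sl) /rip ip0l.
    by rewrite leNgt; apply/negP => lt; case: (nx x).
  by rewrite -/g gerDl leNgt d0.
have nx := nrm_gt0 x0.
exists x => // P [/xe' /le_trans->//|->{P}].
  by rewrite ler_wpM2r ?nrm_ge0 // ge_min lexx.
rewrite -/G; pose s := (2 * c)^-1.
have s0 : 0 < s by rewrite invr_gt0 mulr_gt0.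
have sc : s * c = 2^-1 by rewrite /s; field; rewrite gt_eqF.
pose y := x - s%:C%C *: G x.
have nsG : nrm (s%:C%C *: G x) <= nrm x / 2.
  rewrite (nrmZr _ (ltW s0)) // (le_trans (ler_wpM2l (ltW s0) (GC x))) //.
  by rewrite mulrA sc mulrC.
have yx : nrm x / 2 <= nrm y.
  have := nrm_tri x (s%:C%C *: G x); rewrite -/y; lra.
have xy : nrm y <= 3 / 2 * nrm x by have := nrmB x (s%:C%C *: G x); rewrite -/y; lra.
have ye1 : jnull Ps e1 y.
  move=> P PP; have [Pl PS] := PsS _ PP.
  have -> : P y = P x - s%:C%C *: G (P x).
    by rewrite (linB Pl) (linZ Pl) (linB Pl) PS (linZ Pl).
  rewrite (le_trans (nrmB _ _)) // (nrmZr _ (ltW s0)) //.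
  have h1 := ler_wpM2l (ltW s0) (GC (P x)).
  rewrite mulrA sc in h1.
  have h2 : nrm (P x) <= e1 / 3 * nrm x.
    by rewrite (le_trans (xe' _ PP)) // ler_wpM2r ?nrm_ge0 // ge_min lexx orbT.
  by have := ler_wpM2l (ltW e10) yx; lra.
have := te1 _ ye1.
have -> : S y = G y + g%:C%C *: y by rewrite subrK.
have Gxx : rip (G x) x < d * nrm x ^+ 2.
  by rewrite ripBl ripZl rip_nrm; lra.
have GGG : rip (G (G x)) (G x) <= c * nrm (G x) ^+ 2.
  rewrite (le_trans (cauchy_schwarz _ _)) // expr2 mulrA.
  by rewrite ler_wpM2r ?nrm_ge0.
rewrite ripDl ripZl rip_nrm => tyg.
have yd : - d * nrm y ^+ 2 <= rip (G y) y.
  have := ler_wpM2r (exprn_ge0 2 (nrm_ge0 y)) (ltW gt); rewrite -/g; lra.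
(* Moving from [x] to [y] lowers the form by 2 s |G x|^2, up to a second-order term of at most (s /
   2) |G x|^2. As [x] is minimal within [d], this forces G x to be small. *)
have : rip (G y) y = rip (G x) x - 2 * s * nrm (G x) ^+ 2
                     + s ^+ 2 * rip (G (G x)) (G x).
  have bil a b u v : rip (a - s%:C%C *: b) (u - s%:C%C *: v) =
      rip a u - s * rip a v - s * rip b u + s ^+ 2 * rip b v.
    by rewrite ripBl !ripBr !ripZl !ripZr; ring.
  rewrite /y (linB Gl) (linZ Gl) bil.
  have -> : rip (G (G x)) x = nrm (G x) ^+ 2 by rewrite sG rip_nrm.
  by rewrite rip_nrm; ring.
move=> eqG; rewrite {}eqG in yd.
have xy2 : nrm y ^+ 2 <= 9 / 4 * nrm x ^+ 2 by have := nrm_ge0 y; nra.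
have G2 : s ^+ 2 * rip (G (G x)) (G x) <= s / 2 * nrm (G x) ^+ 2.
  have -> : s / 2 = s ^+ 2 * c by rewrite expr2 -mulrA sc.
  by rewrite -mulrA ler_wpM2l // sqr_ge0.
have dy : d * nrm y ^+ 2 <= d * (9 / 4 * nrm x ^+ 2) by rewrite ler_wpM2l // ltW.
have : 3 / 2 * s * nrm (G x) ^+ 2 <= 13 / 4 * d * nrm x ^+ 2 by lra.
have -> : s = 1 / 2 / c by rewrite /s; field; rewrite gt_eqF.
rewrite /d => H.
have {}H : nrm (G x) ^+ 2 <= 26 / 36 * (e ^+ 2 * nrm x ^+ 2).
  rewrite -(ler_pM2l (x := 3 / 2 * (1 / 2 / c))); last by rewrite !mulr_gt0 // invr_gt0.
  rewrite (le_trans H) // le_eqVlt; apply/orP; left; apply/eqP; field.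
  by rewrite gt_eqF.
rewrite -(ler_pXn2r (n := 2)) ?nnegrE ?nrm_ge0 ?mulr_ge0 ?nrm_ge0 // ?(ltW e0) //.
rewrite exprMn (le_trans H) //.
have : 0 <= e ^+ 2 * nrm x ^+ 2 by rewrite mulr_ge0 ?sqr_ge0.
lra.
Qed.

End RealInnerProduct.

(** * Polynomials in an operator *)

Section PolynomialCalculus.
Variables (R : realType) (V : completeNormedModType R[i]).
Implicit Types (x y : V) (c z : R[i]) (p q : {poly R[i]}) (f g : V -> V).

(** The operator p(f), given pointwise because operators are bare functions here. *)
Definition pev f p x := \sum_(i < size p) p`_i *: iter i f x.

Lemma pevE f n p x : (size p <= n)%N -> pev f p x = \sum_(i < n) p`_i *: iter i f x.
Proof.
move=> pn; rewrite /pev (big_ord_widen n (fun i => p`_i *: iter i f x)) //.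
rewrite big_mkcond /=; apply: eq_bigr => i _; case: ltnP => // /leq_sizeP.
by move=> /(_ i (leqnn _)) ->; rewrite scale0r.
Qed.

Lemma pevD f p q x : pev f (p + q) x = pev f p x + pev f q x.
Proof.
pose n := maxn (size p) (size q).
rewrite !(@pevE f n) ?leq_maxl ?leq_maxr ?size_polyD // -big_split /=.
by apply: eq_bigr => i _; rewrite coefD scalerDl.
Qed.

Lemma pevC f c x : pev f c%:P x = c *: x.
Proof. by rewrite (@pevE f 1) ?size_polyC_leq1 // big_ord1 coefC. Qed.

Lemma pevMX f p x : pev f (p * 'X) x = pev f p (f x).
Proof.
rewrite (@pevE f (size p).+1); last first.
  by rewrite (leq_trans (size_polyMleq _ _)) // size_polyX addn2.
rewrite big_ord_recl coefMX eqxx scale0r add0r.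
by apply: eq_bigr => i _; rewrite coefMX iterSr.
Qed.

Lemma pevZ f c p x : islin f -> pev f (c *: p) x = c *: pev f p x.
Proof.
move=> fl; rewrite (@pevE f (size p)) ?size_scale_leq // /pev scaler_sumr.
by apply: eq_bigr => i _; rewrite coefZ scalerA.
Qed.

Lemma pev_comm f g p x : islin g -> (forall x, f (g x) = g (f x)) ->
  pev f p (g x) = g (pev f p x).
Proof.
move=> gl fg; rewrite /pev.
rewrite (big_morph g (linD gl) (lin0 gl)); apply: eq_bigr => i _.
rewrite (linZ gl); congr (_ *: _).
by elim: (nat_of_ord i) => //= k ->.
Qed.

Lemma pevM f p q x : islin f -> pev f (p * q) x = pev f p (pev f q x).
Proof.
move=> fl; elim/poly_ind: p x => [|p c IH] x.
  by rewrite mul0r -polyC0 !pevC !scale0r.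
rewrite mulrDl -mulrA (mulrC 'X) mulrA mul_polyC !pevD !pevMX pevC pevZ //.
by rewrite IH (@pev_comm f f q).
Qed.

Lemma pevX f x : pev f 'X x = f x.
Proof. by rewrite -['X]mul1r pevMX pevC scale1r. Qed.

Lemma pevXsubC f c x : pev f ('X - c%:P) x = Defs.shift f c x.
Proof. by rewrite pevD pevX -polyCN pevC scaleNr. Qed.

Lemma pevXn f n x : islin f -> pev f 'X^n x = iter n f x.
Proof.
move=> fl; elim: n x => [|n IH] x; first by rewrite expr0 pevC scale1r.
by rewrite exprS pevM // IH pevX.
Qed.

Lemma pevXsubC_exp f c m x : islin f ->
  pev f (('X - c%:P) ^+ m) x = iter m (Defs.shift f c) x.
Proof.
move=> fl; elim: m x => [|m IH] x; first by rewrite expr0 pevC scale1r.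
by rewrite exprS pevM // IH pevXsubC.
Qed.

Lemma blin_pev f p : blin f -> blin (pev f p).
Proof.
move=> bf; elim/poly_ind: p => [|p c IH].
  have -> : pev f 0 = (fun x => 0 *: x).
    by apply/funext => x; rewrite -polyC0 pevC.
  exact: (blin_scale 0 (blin_id V)).
have -> : pev f (p * 'X + c%:P) = (fun x => pev f p (f x) + c *: x).
  by apply/funext => x; rewrite pevD pevMX pevC.
exact: (blin_add (blin_comp IH bf) (blin_scale c (blin_id V))).
Qed.

(* A factor [A - z] with [z] away from [l] is harmless on vectors which
   [A - l] almost kills: there it acts almost as [l - z], and it enlarges the
   ratio [|(A - l) x| / |x|] by a factor at most [2 (C + e) / e]. *)
Lemma prod_bounded_below (A : V -> V) l (e C : R) : islin A -> 0 < e -> 0 < C ->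
  (forall x, nrm (Defs.shift A l x) <= C * nrm x) ->
  (forall z, z != l -> cabs (z - l) < e ->
     exists2 c : R, 0 < c & forall x, c * nrm x <= nrm (Defs.shift A z x)) ->
  forall (r : seq R[i]) (h : R), l \notin r -> 0 <= h ->
  h * (2 * (C + e) / e) ^+ size r <= e / 2 ->
  exists2 c : R, 0 < c & forall x, nrm (Defs.shift A l x) <= h * nrm x ->
     c * nrm x <= nrm (pev A (\prod_(z <- r) ('X - z%:P)) x).
Proof.
move=> Al e0 C0 TC near; set K := 2 * (C + e) / e.
have K1 : 1 <= K by rewrite /K ler_pdivlMr //; lra.
elim=> [|z r IH] h lr h0 he.
  by exists 1 => // x _; rewrite big_nil pevC scale1r mul1r.
move: lr; rewrite inE negb_or => /andP[lz lr].
have K0 : 0 <= K by exact: le_trans K1.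
(* A root near [l] is applied last: its factor is bounded below on all of [V], so [h] need not
   change. *)
have [zl|zl] := ltP (cabs (z - l)) e.
  have [|c c0 rc] := IH h lr h0.
    rewrite (le_trans _ he) // ler_wpM2l // exprS ler_peMl // exprn_ge0 //.
  rewrite eq_sym in lz; have [d d0 zd] := near _ lz zl.
  exists (d * c) => [|x Tx]; first exact: mulr_gt0.
  rewrite big_cons pevM // pevXsubC (le_trans _ (zd _)) // -mulrA ler_pM2l //.
  exact: rc.
(* A root far from [l] is applied first: the induction hypothesis is used at (A - z) x, with the
   enlarged ratio [h * K]. *)
have [||c c0 rc] := IH (h * K) lr; first exact: mulr_ge0.
  by rewrite -mulrA -exprS.
set d := cabs (z - l) in zl.
have d0 : 0 < d by lra.
have hd : h <= d / 2.
  have : h * 1 <= h * K ^+ (size r).+1 by rewrite ler_wpM2l // exprn_ege1.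
  rewrite mulr1 => /le_trans/(_ he) => hh; lra.
exists (c * (d / 2)) => [|x Tx]; first by rewrite !mulr_gt0.
rewrite big_cons (mulrC ('X - _)) pevM // pevXsubC.
have shE x' : Defs.shift A z x' = Defs.shift A l x' - (z - l) *: x'.
  by rewrite /Defs.shift scalerBl opprB addrA subrK.
have nx := nrm_ge0 x.
have zx : d / 2 * nrm x <= nrm (Defs.shift A z x).
  have := nrm_tri ((z - l) *: x) (Defs.shift A l x).
  rewrite nrmC -shE nrmZ -/d => H1.
  have H2 : h * nrm x <= d / 2 * nrm x by rewrite ler_wpM2r.
  lra.
rewrite -mulrA (le_trans (ler_wpM2l (ltW c0) zx)) //.
apply: rc.
have Tlin : islin (Defs.shift A l).
  move=> a u v; rewrite /Defs.shift Al scalerDr scalerBr !scalerA (mulrC l).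
  by rewrite opprD addrACA.
have -> : Defs.shift A l (Defs.shift A z x) =
    Defs.shift A l (Defs.shift A l x) - (z - l) *: Defs.shift A l x.
  by rewrite shE (linB Tlin) (linZ Tlin).
rewrite (le_trans (nrmB _ _)) // nrmZ -/d.
have T2 := TC (Defs.shift A l x).
have nT := nrm_ge0 (Defs.shift A l x).
have H1 : (C + d) * nrm (Defs.shift A l x) <= (C + d) * (h * nrm x).
  by rewrite ler_wpM2l //; lra.
have H2 : (C + d) <= K * (d / 2).
  rewrite /K -(ler_pM2l e0).
  have -> : e * (2 * (C + e) / e * (d / 2)) = (C + e) * d by field; rewrite gt_eqF.
  by nra.
have H3 : (C + d) * (h * nrm x) <= K * (d / 2) * (h * nrm x).
  by rewrite ler_wpM2r // mulr_ge0.
have H4 : h * K * (d / 2 * nrm x) <= h * K * nrm (Defs.shift A z x).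
  by rewrite ler_wpM2l // mulr_ge0.
lra.
Qed.

End PolynomialCalculus.

(** * Approximate eigenvalues of normal operators, and the gap *)

Section SpectralGap.
Variables (R : realType) (V : completeNormedModType R[i]) (ip : V -> V -> R[i]).
Hypothesis hip : hilbert_inner_product ip.
Implicit Types (x y : V) (f g : V -> V).


Lemma shift_comm f g c x : islin g -> (forall x, f (g x) = g (f x)) ->
  Defs.shift f c (g x) = g (Defs.shift f c x).
Proof. by move=> gl fg; rewrite /Defs.shift fg (linB gl) (linZ gl). Qed.

Lemma radj_comm f f' g g' : radj ip f f' -> radj ip g g' ->
  (forall x, f (g x) = g (f x)) -> forall x, f' (g' x) = g' (f' x).
Proof.
move=> ff gg fg x; apply: (rip_inj hip) => z.
by rewrite -ff -gg -fg ff gg.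
Qed.

Lemma iter_comm f g n x : (forall x, f (g x) = g (f x)) ->
  iter n f (g x) = g (iter n f x).
Proof. by move=> fg; elim: n => //= n ->. Qed.

(** Since N = (S1 - i S2) / 2 with [S1] and [S2] self-adjoint, approximate eigenvalues a and b of
    these combine to w = (a - i b) / 2. Normality makes [S1] and [S2] commute, so localising at [S2]
    can keep the localisation at [S1]. *)
Lemma jsing_normal (Ps : set (V -> V)) N Ns :
  blin N -> radj ip N Ns -> (forall x, Ns (N x) = N (Ns x)) ->
  (forall P, Ps P -> [/\ islin P, forall x, P (N x) = N (P x) &
     forall x, P (Ns x) = Ns (P x)]) ->
  jsing Ps -> exists w, jsing (Ps `|` [set Defs.shift N w])%classic.
Proof.
move=> bN NNs NsN PsN sing.
have bNs := radj_blin hip bN NNs.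
have [[Nl _] [Nsl _]] := (bN, bNs).
pose S1 x := N x + Ns x; pose S2 x := ('i%C : R[i]) *: (N x - Ns x).
have bS1 : blin S1 by exact: blin_add.
have bS2 : blin S2 by apply: blin_scale; exact: blin_sub.
have aS1 : radj ip S1 S1.
  by move=> x y; rewrite /S1 ripDl // ripDr // NNs -(radjC hip NNs) addrC.
have aS2 : radj ip S2 S2.
  move=> x y; rewrite /S2 ripZadj // ripBl // NNs (radjC hip NNs) -ripBr //.
  rewrite (linZ Nsl) (linZ Nl) -scalerBr.
  have -> : conjc ('i%C : R[i]) = - 'i%C.
    by apply/eqP; rewrite eq_complex /= oppr0 !eqxx.
  by rewrite scaleNr -scalerN opprB.
have S12 x : S1 (S2 x) = S2 (S1 x).
  rewrite /S1 /S2 (linZ Nl) (linZ Nsl) -scalerDr; congr (_ *: _).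
  by rewrite (linB Nl) (linB Nsl) (linD Nl) (linD Nsl) NsN addrA subrK opprD addrA addrK.
have [|a [sing1 _]] := jsing_localize hip (S := S1) _ bS1 aS1 sing.
  by move=> P /PsN[Pl PN PNs]; split=> // x; rewrite (linD Pl) PN PNs.
have [|b [sing2 _]] := jsing_localize hip (S := S2) _ bS2 aS2 sing1.
  move=> P [/PsN[Pl PN PNs]|->].
    by split=> // x; rewrite (linZ Pl) (linB Pl) PN PNs.
  split; first by case: (blin_shift a%:C%C bS1).
  by move=> x; apply: shift_comm; [case: bS2 | exact: S12].
pose hf : R[i] := (2^-1 : R)%:C%C.
exists (hf * (a%:C%C - 'i%C * b%:C%C)) => e e0.
have [x x0 xe] := sing2 _ e0; exists x => // P [PP|->].
  by apply: xe; left; left.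
have xa : nrm (Defs.shift S1 a%:C%C x) <= e * nrm x by apply: xe; left; right.
have xb : nrm (Defs.shift S2 b%:C%C x) <= e * nrm x by apply: xe; right.
set w := hf * _.
have hfD : hf + hf = 1.
  by rewrite /hf -rmorphD /= -(rmorph1 (real_complex R)) -div1r -splitr.
have S2E : (hf * 'i%C) *: Defs.shift S2 b%:C%C x =
    - (hf *: (N x - Ns x)) - (hf * ('i%C * b%:C%C)) *: x.
  rewrite /Defs.shift scalerBr !scalerA -[hf * 'i%C * 'i%C]mulrA.
  by rewrite -[hf * 'i%C * b%:C%C]mulrA -expr2 sqr_i mulrN1 scaleNr.
have -> : Defs.shift N w x = hf *: Defs.shift S1 a%:C%C x
     - (hf * 'i%C) *: Defs.shift S2 b%:C%C x.
  rewrite S2E opprD !opprK addrA -scalerDr /Defs.shift /S1.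
  rewrite [_ + _ - _ + _]addrAC [_ + _ + (_ - _)]addrACA subrr addr0.
  rewrite scalerBr scalerDr -scalerDl hfD scale1r scalerA.
  by rewrite /w mulrBr scalerBl opprD opprK addrA.
have ci : cabs (hf * 'i%C) = 2^-1 :> R.
  rewrite /cabs normc_def /= !mul0r mulr0 subr0 mulr1 addr0 expr0n add0r.
  by rewrite sqrtr_sqr ger0_norm // invr_ge0.
rewrite (le_trans (nrmB _ _)) // !nrmZ ci.
rewrite cabs_real ger0_norm ?invr_ge0 //; lra.
Qed.

Variables (n : nat) (A As : V -> V).
Hypotheses (n0 : (0 < n)%N) (bA : blin A) (adjA : radj ip A As)
  (nnormal : forall x, As (iter n A x) = iter n A (As x)).

Lemma nnormal_adj x : iter n As (iter n A x) = iter n A (iter n As x).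
Proof. exact: iter_comm. Qed.

Lemma range_bounded_below (l : R[i]) (e : R) : 0 < e ->
  (forall z, z != l -> cabs (z - l) < e ->
     exists2 c : R, 0 < c & forall x, c * nrm x <= nrm (Defs.shift A z x)) ->
  exists2 h : R, 0 < h & forall x,
    h * nrm (Defs.shift (iter n A) (l ^+ n) x) <=
    nrm (Defs.shift A l (Defs.shift (iter n A) (l ^+ n) x)).
Proof.
move=> e0 near.
set T := Defs.shift A l; set N := iter n A; set M := Defs.shift N (l ^+ n).
pose Ns := iter n As; pose Ms := Defs.shift Ns (conjc (l ^+ n)).
pose Ts := Defs.shift As (conjc l).
have bAs := radj_blin hip bA adjA.
have [[Al _] [Asl _]] := (bA, bAs).
have bN : blin N by exact: blin_iter.
have bNs : blin Ns by exact: blin_iter.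
have [[Nl _] [Nsl _]] := (bN, bNs).
have bM : blin M by exact: blin_shift.
have bMs : blin Ms by exact: blin_shift.
have bT : blin T by exact: blin_shift.
have bTs : blin Ts by exact: blin_shift.
have aN : radj ip N Ns by exact: radj_iter.
have aM : radj ip M Ms by exact: radj_shift.
have aT : radj ip T Ts by exact: radj_shift.
have [Tl [C C0 TC]] := bT.
pose K := 2 * (C + e) / e.
have K0 : 0 < K by rewrite divr_gt0 // mulr_gt0 // addr_gt0.
(* Chosen so that h K^n = e / 2, the threshold of [prod_bounded_below] for [n] roots. *)
pose h := e / 2 / K ^+ n.
have h0 : 0 < h by rewrite !divr_gt0 // exprn_gt0.
exists h => // x0; rewrite leNgt; apply/negP => x0h.
pose D := Defs.shift (fun x => Ts (T x)) (h ^+ 2)%:C%C.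
(* The quadratic form of [J] is |T M x|^2 - h^2 |M x|^2, negative at [x0]. *)
pose J x := Ms (D (M x)).
have bD : blin D by apply: blin_shift; exact: blin_comp.
have bJ : blin J by exact: (blin_comp bMs (blin_comp bD bM)).
have aD : radj ip D D.
  rewrite /D -[X in radj _ _ (Defs.shift _ X)]conjc_real.
  by apply: radj_shift => // x y; rewrite (radjC hip aT) aT.
have aJ : radj ip J J by move=> x y; rewrite /J (radjC hip aM) aD aM.
have ripJ x : rip ip (J x) x = nrm (T (M x)) ^+ 2 - h ^+ 2 * nrm (M x) ^+ 2.
  rewrite /J (radjC hip aM) /D /Defs.shift ripBl // ripZl // rip_nrm //.
  by rewrite (radjC hip aT) rip_nrm.
have NA x : A (N x) = N (A x) by rewrite /N -iterS iterSr.
have NJ x : J (N x) = N (J x).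
  rewrite /J /M shift_comm // /D shift_comm //; last first.
    move=> y; rewrite /T shift_comm // /Ts shift_comm //.
  rewrite /Ms shift_comm // => y; exact: nnormal_adj.
have NsJ x : J (Ns x) = Ns (J x) by exact: (radj_comm aJ aN NJ).
have x00 : x0 != 0.
  apply: contraTneq x0h => ->.
  by rewrite (lin0 bM.1) (lin0 Tl) nrm0 mulr0 ltxx.
(* For the empty family every vector is null, so [g] will lie at or below the form of [J] at the
   normalised [x0]. *)
have sing0 : jsing (set0 : set (V -> V)) by move=> d d0; exists x0.
have [//|g [singJ gJ]] := jsing_localize hip _ bJ aJ sing0.
have {}gJ : g < 0.
  have := gJ x0 (fun P F => False_ind _ F).
  rewrite ripJ => gx.
  have : g * nrm x0 ^+ 2 < 0.
    rewrite (le_lt_trans gx) // subr_lt0 -exprMn ltr_pXn2r // ?nnegrE ?nrm_ge0 //.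
    by rewrite mulr_ge0 ?nrm_ge0 // ltW.
  by rewrite pmulr_llt0 // exprn_gt0 // nrm_gt0.
rewrite set0U in singJ.
have [P ->|w sing] := jsing_normal bN aN nnormal_adj _ singJ.
  split; first by case: (blin_shift g%:C%C bJ).
    by move=> x; exact: shift_comm.
  by move=> x; exact: shift_comm.
(* An approximate eigenvector for [g] with error at most k has (J x, x) <= - k |x|^2. This yields
   both |T M x| <= h |M x| and a lower bound for |M x|. *)
pose k := - g / 2.
have k0 : 0 < k by rewrite /k; lra.
have {}sing d : 0 < d -> exists x, [/\ x != 0,
    nrm (Defs.shift N w x) ^+ 2 <= d * nrm x ^+ 2,
    nrm (T (M x)) <= h * nrm (M x) & k * nrm x ^+ 2 <= h ^+ 2 * nrm (M x) ^+ 2].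
  move=> d0; pose d' := Num.min k (Num.min 1 d).
  have d'0 : 0 < d' by rewrite !lt_min k0 d0 ltr01.
  have [x x00' xd] := sing _ d'0; exists x.
  have nx : 0 < nrm x ^+ 2 by rewrite exprn_gt0 // nrm_gt0.
  have kJ : k * nrm x ^+ 2 <= h ^+ 2 * nrm (M x) ^+ 2 - nrm (T (M x)) ^+ 2.
    have h1 : nrm (Defs.shift J g%:C%C x) <= k * nrm x.
      rewrite (le_trans (xd _ _)) ?ler_wpM2r ?nrm_ge0 // ?ge_min ?lexx //.
      by left.
    have := cauchy_schwarz hip (Defs.shift J g%:C%C x) x.
    rewrite ripBl // ripZl // ripJ rip_nrm // => h2.
    have := ler_wpM2r (nrm_ge0 x) h1; rewrite -mulrA -expr2 /k; lra.
  split=> //.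
  - have h1 : nrm (Defs.shift N w x) <= d' * nrm x by apply: xd; right.
    have : nrm (Defs.shift N w x) ^+ 2 <= (d' * nrm x) ^+ 2.
      by rewrite ler_pXn2r ?nnegrE ?nrm_ge0 // mulr_ge0 ?nrm_ge0 // ltW.
    move=> /le_trans; apply; rewrite exprMn ler_pM2r // expr2.
    have d1 : d' <= 1 by rewrite !ge_min lexx orbT.
    have dd : d' <= d by rewrite !ge_min lexx !orbT.
    by rewrite (le_trans _ dd) // ler_piMl // ltW.
  - rewrite -(ler_pXn2r (n := 2)) ?nnegrE ?nrm_ge0 ?(mulr_ge0 (ltW h0) (nrm_ge0 _)) //.
    rewrite exprMn; have := mulr_ge0 (ltW k0) (ltW nx); lra.
  - by have := sqr_ge0 (nrm (T (M x))); lra.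
have h20 : 0 < h ^+ 2 by rewrite exprn_gt0.
(* Otherwise M x would be arbitrarily small relative to [x], against that lower bound. *)
have wl : w != l ^+ n.
  apply/eqP => wl; have q0 : 0 < k / (2 * h ^+ 2) by rewrite divr_gt0 // mulr_gt0.
  have [x [x00' xd _ kx]] := sing _ q0.
  rewrite wl -/M in xd.
  have nx : 0 < nrm x ^+ 2 by rewrite exprn_gt0 // nrm_gt0.
  have := ler_wpM2l (ltW h20) xd.
  have -> : h ^+ 2 * (k / (2 * h ^+ 2) * nrm x ^+ 2) = k * nrm x ^+ 2 / 2.
    by field; rewrite gt_eqF.
  have := mulr_gt0 k0 nx; lra.
have [r rE] := closed_field_poly_normal ('X^n - w%:P : {poly R[i]}).
rewrite lead_coefXnsubC // scale1r in rE.
have sr : size r = n.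
  have := size_XnsubC w n0; rewrite rE size_prod_XsubC; by case.
have lr : l \notin r.
  rewrite -root_prod_XsubC -rE rootE !hornerE /= subr_eq0.
  by rewrite eq_sym.
have [|c c0 rc] := prod_bounded_below Al e0 C0 TC near lr (ltW h0).
  by rewrite sr /h divfK // expf_neq0 // gt_eqF.
have [Ml [CM CM0 MC]] := bM.
(* This tolerance gives c |M x| <= |(N - w) M x| = |M (N - w) x| and hence |M x|^2 <= k |x|^2 / (2
   h^2), half of what the lower bound demands. *)
have d0 : 0 < c ^+ 2 * k / (2 * CM ^+ 2 * h ^+ 2).
  apply: divr_gt0; first exact: mulr_gt0 (exprn_gt0 2 c0) k0.
  exact: mulr_gt0 (mulr_gt0 (ltr0Sn _ 1) (exprn_gt0 2 CM0)) h20.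
have [x [x00' xd Tx kx]] := sing _ d0.
have nx : 0 < nrm x ^+ 2 by rewrite exprn_gt0 // nrm_gt0.
have := rc _ Tx; rewrite -rE pevD pevXn // -polyCN pevC scaleNr.
rewrite -/N -[N (M x) - _]/(Defs.shift N w (M x)).
rewrite shift_comm //; last by move=> y; rewrite /M shift_comm.
move=> /le_trans/(_ (MC _)).
rewrite -(ler_pXn2r (n := 2)) ?nnegrE ?mulr_ge0 ?nrm_ge0 ?(ltW c0) ?(ltW CM0) //.
rewrite !exprMn => H.
have := le_trans H (ler_wpM2l (sqr_ge0 CM) xd).
have -> : CM ^+ 2 * (c ^+ 2 * k / (2 * CM ^+ 2 * h ^+ 2) * nrm x ^+ 2) =
   c ^+ 2 * (k * nrm x ^+ 2 / (2 * h ^+ 2)).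
  by field; rewrite !gt_eqF.
rewrite ler_pM2l ?exprn_gt0 // ler_pdivlMr; last exact: mulr_gt0 (ltr0Sn _ 1) h20.
have := mulr_gt0 k0 nx; lra.
Qed.

End SpectralGap.

(** * Equality of ascent and descent *)

Section AscentDescent.
Variables (R : realType) (V : completeNormedModType R[i]) (T : V -> V).
Hypothesis Tl : islin T.

Definition kernel_stable k := forall x, iter k.+1 T x = 0 -> iter k T x = 0.
Definition range_stable k := forall x, exists y, iter k.+1 T y = iter k T x.

Lemma islin_iter k : islin (iter k T).
Proof. by elim: k => [//|k IH] a x y /=; rewrite IH Tl. Qed.

Lemma kerp_stable k : kerp T k = kerp T k.+1 <-> kernel_stable k.
Proof.
split=> [kE x xk|ks]; first by have : kerp T k x by rewrite kE.
apply/seteqP; split=> x; rewrite /kerp /=; last exact: ks.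
by move=> ->; exact: lin0.
Qed.

Lemma ranp_stable k : ranp T k = ranp T k.+1 <-> range_stable k.
Proof.
split=> [kE x|ks].
  by have : ranp T k (iter k T x) by [exists x]; rewrite kE.
apply/seteqP; split=> y [x <-]; first exact: ks.
by exists (T x); rewrite -iterSr.
Qed.

Lemma kernel_stable_add k j x : kernel_stable k ->
  iter (k + j) T x = 0 -> iter k T x = 0.
Proof.
move=> ks; elim: j x => [|j IH] x; first by rewrite addn0.
rewrite addnS iterSr => /IH; rewrite -iterSr; exact: ks.
Qed.

(** Up to index [m], kernels are stable at k exactly when ranges are, so both chains stabilise first
    at the same index. That index is positive, for stability at 0 means bijectivity. *)
Lemma stable_pole m : kernel_stable m -> range_stable m ->
  ~ ((forall x, T x = 0 -> x = 0) /\ (forall y, exists x, T x = y)) ->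
  exists p : nat, [/\ (0 < p)%N, ascent_is T p & descent_is T p].
Proof.
move=> km rm nbij.
have range_add k j x : range_stable k -> exists y, iter (k + j) T y = iter k T x.
  move=> rs; elim: j => [|j [y <-]]; first by exists x; rewrite addn0.
  have [z zE] := rs y; exists z.
  by rewrite addnS -addSn addnC iterD zE -iterD addnC.
have kr k : (k <= m)%N -> kernel_stable k -> range_stable k.
  move=> lekm ks x; have [y yE] := rm x; exists y.
  (* From T^m x = T^(m+1) y, the vector x - T y is in the kernel of T^m, hence in that of T^k. *)
  have /(kernel_stable_add (j := m - k) ks) : iter (k + (m - k)) T (x - T y) = 0.
    by rewrite subnKC // (linB (islin_iter m)) -iterSr yE subrr.
  by rewrite (linB (islin_iter k)) -iterSr => /subr0_eq.
have rk k : (k <= m)%N -> range_stable k -> kernel_stable k.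
  move=> lekm rs x xk; have [y] := range_add k (m - k)%N x rs.
  rewrite subnKC // => yE; rewrite -yE; apply: km.
  by rewrite iterS yE -iterS.
have ex : exists k, `[< kernel_stable k >] by exists m; apply/asboolP.
case: (ex_minnP ex) => p /asboolP kp pmin.
have pm : (p <= m)%N by apply: pmin; apply/asboolP.
have nk q : (q < p)%N -> ~ kernel_stable q.
  by move=> qp /asboolP /pmin; rewrite leqNgt qp.
exists p; split.
- rewrite lt0n; apply/eqP => p0; apply: nbij; rewrite p0 in kp pm.
  by split; [exact: kp | exact: (kr _ pm kp)].
- by split=> [|q /nk nq]; [exact/kerp_stable | move=> /kerp_stable].
- split=> [|q qp]; first by apply/ranp_stable; exact: kr.
  move=> /ranp_stable /rk nq; apply: (nk _ qp); apply: nq.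
  exact: leq_trans (ltnW qp) pm.
Qed.

End AscentDescent.

(** * From the gap to a pole *)

Section Pole.
Variables (R : realType) (V : completeNormedModType R[i]) (A : V -> V).
Variables (n : nat) (l : R[i]) (e h : R).
Hypotheses (bA : blin A) (n0 : (0 < n)%N) (e0 : 0 < e) (h0 : 0 < h).
Let T := Defs.shift A l.
Let M := Defs.shift (iter n A) (l ^+ n).
Hypothesis resolvent : forall z, z != l -> cabs (z - l) < e ->
  exists B : V -> V, [/\ blin B, forall x, B (Defs.shift A z x) = x &
    forall x, Defs.shift A z (B x) = x].
Hypothesis TM : forall x, h * nrm (M x) <= nrm (T (M x)).

Definition range_closure y := forall d : R, 0 < d -> exists v, nrm (y - M v) < d.

Let bT : blin T. Proof. exact: blin_shift. Qed.
Let bM : blin M. Proof. by apply: blin_shift; exact: blin_iter. Qed.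

Lemma range_closure_lim y :
  (forall d, 0 < d -> exists2 u, range_closure u & nrm (y - u) < d) ->
  range_closure y.
Proof.
move=> yl d d0; have d20 : 0 < d / 2 by rewrite divr_gt0.
have [u /(_ _ d20)[v uv] yu] := yl _ d20; exists v.
have -> : y - M v = (y - u) + (u - M v) by rewrite addrA subrK.
rewrite (le_lt_trans (nrmD _ _)) //; lra.
Qed.

Lemma range_closureB x y : range_closure x -> range_closure y -> range_closure (x - y).
Proof.
move=> xl yl d d0; have d20 : 0 < d / 2 by rewrite divr_gt0.
have [[v xv] [w yw]] := (xl _ d20, yl _ d20); exists (v - w).
have -> : x - y - M (v - w) = (x - M v) - (y - M w).
  by rewrite (linB bM.1) !opprD !opprK addrACA.
rewrite (le_lt_trans (nrmB _ _)) //; lra.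
Qed.

(** The gap passes to the closure by continuity: replacing y by M v at distance r costs at most (h +
    C) r. *)
Lemma range_closure_bounded_below y : range_closure y -> h * nrm y <= nrm (T y).
Proof.
move=> yl; have [Tl [C C0 TC]] := bT; apply/ler_addgt0Pr => d d0.
have hC : 0 < h + C by exact: addr_gt0.
have [v yv] := yl (d / (h + C)) (divr_gt0 d0 hC).
have H1 : nrm y <= nrm (M v) + nrm (y - M v) by exact: nrm_tri.
have H2 : nrm (T (M v)) <= nrm (T y) + nrm (T (M v) - T y) by exact: nrm_tri.
have H3 := TC (M v - y); rewrite (linB Tl) [nrm (M v - y)]nrmC in H3.
have H4 := TM v; have H5 := ler_wpM2l (ltW h0) H1.
have H6 : (h + C) * nrm (y - M v) <= d by rewrite -ler_pdivlMl // mulrC ltW.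
rewrite mulrDr in H5; rewrite mulrDl in H6; lra.
Qed.

(* The preimage is the limit of [(T - s)^-1 y] as [s] decreases to 0. *)
Lemma range_closure_surjective y : range_closure y ->
  exists2 u, range_closure u & T u = y.
Proof.
move=> yl; have [Tl [C C0 TC]] := bT.
(* The bound [e] gives access to the resolvent; h / 2 lets the gap absorb the perturbation. *)
pose s := Num.min e (h / 2).
have s0 : 0 < s by rewrite lt_min e0 divr_gt0.
(* Starting at 2 keeps every [a k] strictly below [s]. *)
pose a k : R := s / k.+2%:R.
have a0 k : 0 < a k by rewrite divr_gt0.
have as_ k : a k < s by rewrite /a ltr_pdivrMr // ltr_pMr // ltr1n.
have alim d : 0 < d -> exists N, forall k, (N <= k)%N -> a k < d.
  move=> d0; exists (Num.bound (s / d)) => k Nk.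
  rewrite /a ltr_pdivrMr // mulrC -ltr_pdivrMr //.
  apply: (lt_le_trans (archi_boundP (divr_ge0 (ltW s0) (ltW d0)))).
  by rewrite ler_nat (leq_trans Nk) // leqW.
have /choice[u uP] : forall k, exists u, range_closure u /\ T u = y + (a k)%:C%C *: u.
  move=> k; have [||B [bB BT TB]] := @resolvent (l + (a k)%:C%C).
  - rewrite -subr_eq0 addrC addKr; apply/eqP => /(congr1 (@complex.Re R)) /= /eqP.
    by rewrite gt_eqF.
  - rewrite addrC addKr cabs_real gtr0_norm //.
    by rewrite (lt_le_trans (as_ k)) // ge_min lexx.
  have [Bl [D D0 BD]] := bB.
  exists (B y); split; last first.
    have := TB y; rewrite /T /Defs.shift scalerDl opprD addrA => /eqP.
    by rewrite subr_eq => /eqP.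
  (* The resolvent commutes with [A], hence with [M], and so preserves the closure of the range of
     [M]. *)
  have AB x : A (B x) = B (A x).
    apply: (addIr (- ((l + (a k)%:C%C) *: B x))).
    by rewrite [LHS]TB -(linZ Bl) -(linB Bl) [RHS]BT.
  have MB x : M (B x) = B (M x).
    by apply: shift_comm => // ?; exact: iter_comm.
  move=> d d0; have [v yv] := yl (d / D) (divr_gt0 d0 D0).
  exists (B v); rewrite MB -(linB Bl) (le_lt_trans (BD _)) //.
  by rewrite -ltr_pdivlMl // mulrC.
(* From h |u| <= |T u| <= |y| + (h / 2) |u|. *)
pose U := 2 * nrm y / h.
have uU k : nrm (u k) <= U.
  have [uL uE] := uP k.
  have := range_closure_bounded_below uL; rewrite uE => H1.
  have := nrmD y ((a k)%:C%C *: u k); rewrite nrmZr ?(ltW (a0 k)) // => H2.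
  have H3 : a k * nrm (u k) <= h / 2 * nrm (u k).
    rewrite ler_wpM2r ?nrm_ge0 // ltW // (lt_le_trans (as_ k)) //.
    by rewrite ge_min lexx orbT.
  rewrite /U ler_pdivlMr //; lra.
have U0 : 0 <= U by exact: le_trans (nrm_ge0 _) (uU 0%N).
have aU d : 0 < d -> exists N, forall k, (N <= k)%N -> nrm ((a k)%:C%C *: u k) < d.
  move=> d0; have U1 : 0 < U + 1 by rewrite ltr_wpDl.
  have [N NP] := alim (d / (U + 1)) (divr_gt0 d0 U1); exists N => k /NP ak.
  rewrite nrmZr ?(ltW (a0 k)) //.
  rewrite (@le_lt_trans _ _ (a k * (U + 1))) //.
    by rewrite ler_wpM2l ?(ltW (a0 k)) // (le_trans (uU k)) // lerDl.
  by rewrite -ltr_pdivlMr.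
(* By the gap, |u i - u j| is controlled by T (u i - u j) = a i u i - a j u j, which tends to 0. *)
have [//|v uv] := @nrm_complete _ _ u.
  move=> d d0; have [N NP] := aU (h * d / 2) (divr_gt0 (mulr_gt0 h0 d0) (ltr0Sn _ 1)).
  exists N => i j /NP ai /NP aj.
  have [[ui uiE] [uj ujE]] := (uP i, uP j).
  have := range_closure_bounded_below (range_closureB ui uj).
  have -> : T (u i - u j) = (a i)%:C%C *: u i - (a j)%:C%C *: u j.
    by rewrite (linB Tl) uiE ujE opprD addrACA subrr add0r.
  move=> H1; have H2 := nrmB ((a i)%:C%C *: u i) ((a j)%:C%C *: u j).
  rewrite -(ltr_pM2l h0); lra.
exists v.
  apply: range_closure_lim => d d0; have [N NP] := uv _ d0.
  by exists (u N); [exact: (uP N).1 | exact: NP].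
apply/eqP; rewrite -subr_eq0; apply/eqP/nrm_eq0/eqP.
rewrite eq_le nrm_ge0 andbT; apply/ler_addgt0Pr => d d0; rewrite add0r.
have d20 : 0 < d / 2 by rewrite divr_gt0.
have [N NP] := uv _ (divr_gt0 d20 C0); have [N' NP'] := aU _ d20.
pose k := maxn N N'.
have H1 := NP k (leq_maxl _ _); have H2 := NP' k (leq_maxr _ _).
have -> : T v - y = T (v - u k) + (a k)%:C%C *: u k.
  by rewrite (linB Tl) (uP k).2 opprD addrA subrK.
rewrite (le_trans (nrmD _ _)) //.
have H3 := TC (v - u k).
have H4 : C * nrm (v - u k) <= d / 2 by rewrite -ler_pdivlMl // mulrC ltW.
lra.
Qed.

Lemma range_closure_iter m y : range_closure y ->
  exists2 u, range_closure u & iter m T u = y.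
Proof.
elim: m y => [|m IH] y yl; first by exists y.
have [u /IH[v vl <-] <-] := range_closure_surjective yl.
by exists v.
Qed.

Lemma range_closureM x : range_closure (M x).
Proof. by move=> d d0; exists x; rewrite subrr nrm0. Qed.

(** Here M = q(A) T^m and q(A) = r(A) T + c with c = q(l) nonzero. Thus [M] agrees with c T^m up to
    a multiple of T^(m+1), which carries the bijectivity of [T] on the closure of the range of [M]
    over to the powers of [T]. *)
Lemma pole_of_gap : spectrum A l -> is_pole A l.
Proof.
move=> specl; have [[Al _] [Tl [C C0 TC]]] := (bA, bT).
have [m [q ql qE]] := multiplicity_XsubC ('X^n - (l ^+ n)%:P : {poly R[i]}) l.
have {}ql : q.[l] != 0.
  by move: ql; rewrite -size_poly_eq0 size_XnsubC //= rootE.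
have [r rE] : exists r, q = r * ('X - l%:P) + q.[l]%:P.
  have /factor_theorem[r rE] : root (q - q.[l]%:P) l.
    by rewrite rootE !hornerE subrr.
  by exists r; rewrite -rE subrK.
set c := q.[l] in ql rE.
have qx x : pev A q x = pev A r (T x) + c *: x.
  by rewrite {1}rE pevD pevM // pevXsubC pevC.
have [bq br] := (blin_pev q bA, blin_pev r bA).
have TA x : A (T x) = T (A x) by rewrite /T /Defs.shift (linB Al) (linZ Al).
have Mq x : M x = pev A q (iter m T x).
  rewrite -pevXsubC_exp // -pevM // -qE pevD pevXn // -polyCN pevC scaleNr //.
have qT p x : pev A p (T x) = T (pev A p x) by exact: pev_comm.
have qTm p k x : pev A p (iter k T x) = iter k T (pev A p x).
  by elim: k => //= k <-.
apply: (stable_pole (m := m) Tl).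
- move=> x xm.
  have Mx : M x = c *: iter m T x.
    by rewrite Mq qx -iterS xm (lin0 br.1) add0r.
  have := range_closure_bounded_below (range_closureM x).
  rewrite Mx (linZ Tl) -iterS xm scaler0 nrm0 pmulr_rle0 // nrmZ.
  rewrite pmulr_rle0 ?cabs_gt0 // => nx; apply: nrm_eq0.
  by apply/eqP; rewrite eq_le nx nrm_ge0.
- move=> x; have [u _ uE] := range_closure_iter m.+1 (range_closureM x).
  (* Solves T^(m+1) u = M x = T^(m+1) r(A) x + c T^m x for T^m x. *)
  exists (c^-1 *: (u - pev A r x)).
  have Tml := islin_iter Tl m.+1.
  rewrite (linZ Tml) (linB Tml) uE Mq qx -iterS qTm addrAC subrr add0r.
  by rewrite scalerA mulVf // scale1r.
move=> [Tinj Tsurj]; apply: specl.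
have Tminj k x : iter k T x = 0 -> x = 0.
  by elim: k => //= k IH /Tinj /IH.
have [[_ [Cq Cq0 qC]] [_ [Cr Cr0 rC]]] := (bq, br).
pose D := (Cq / h + Cr) / cabs c.
have c0 : 0 < cabs c by exact: cabs_gt0.
have D0 : 0 < D by rewrite divr_gt0 // addr_gt0 // divr_gt0.
(* If [T] is bijective, q(A) x lies in the closure of the range of [M], so the gap bounds it by (Cq
   / h) |T x|; then c x = q(A) x - r(A) T x. The inverse of [T] is therefore bounded. *)
have TD x : nrm x <= D * nrm (T x).
  have [u ul uE] := range_closure_iter m (range_closureM x).
  have qu : pev A q x = u.
    apply/eqP; rewrite -subr_eq0; apply/eqP/(Tminj m).
    by rewrite (linB (islin_iter Tl m)) uE Mq qTm subrr.
  have := range_closure_bounded_below ul; rewrite -qu -qT => H1.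
  have H2 := qC (T x); have H3 := rC (T x).
  have H4 : cabs c * nrm x <= nrm (pev A q x) + nrm (pev A r (T x)).
    by rewrite -nrmZ -[c *: x](addKr (pev A r (T x))) -qx addrC nrmB.
  rewrite /D mulrAC ler_pdivlMr // mulrC (le_trans H4) // mulrDl lerD //.
  by rewrite mulrAC ler_pdivlMr // mulrC (le_trans H1).
have /choice[B TB] := Tsurj; exists B; split=> //.
- apply: blin_bounded_op; split.
    move=> a x y; apply/eqP; rewrite -subr_eq0; apply/eqP/Tinj.
    by rewrite (linB Tl) Tl !TB subrr.
  by exists D => // x; rewrite -{2}(TB x).
- move=> x; apply/eqP; rewrite -subr_eq0; apply/eqP/Tinj.
  by rewrite (linB Tl) TB subrr.
Qed.

End Pole.

(** * Isolated spectral points of an n-normal operator *)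

Theorem theorem3p1 (R : realType) (V : completeNormedModType R[i])
  (ip : V -> V -> R[i]) (n : nat) (A : V -> V) :
  hilbert_inner_product ip ->
  infinite_dimensional V ->
  (1 < n)%N ->
  bounded_op A ->
  (exists Astar : V -> V, is_adjoint ip A Astar /\
     (forall x, Astar (iter n A x) = iter n A (Astar x))) ->
  polaroid A.
Proof.
move=> hip _ /ltnW n0 /bounded_op_blin bA [As [AAs nnormal]] l [specl [e [e0 iso]]].
have adjA : radj ip A As by move=> x y; rewrite /rip AAs.
have resolvent z : z != l -> cabs (z - l) < e ->
  exists B : V -> V, [/\ blin B, forall x, B (Defs.shift A z x) = x &
    forall x, Defs.shift A z (B x) = x].
  move=> zl ze; have : ~ spectrum A z.
    by move=> /iso zE; move/eqP: zl; apply; apply: zE; rewrite cabsE ltcR.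
  by move=> /contrapT[B [/bounded_op_blin bB BT TB]]; exists B.
have [|h h0 TM] := range_bounded_below hip n0 bA adjA nnormal (l := l) e0.
  move=> z zl ze; have [B [[_ [C C0 BC]] BT _]] := resolvent z zl ze.
  (* A left inverse bounded by [C] makes A - z bounded below by 1 / C. *)
  exists C^-1 => [|x]; first by rewrite invr_gt0.
  by rewrite ler_pdivrMl // -{1}(BT x).
exact: (pole_of_gap bA n0 e0 h0 resolvent TM specl).
Qed.
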